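(* Let $\mathbb{X}_1 \leftrightarrow \mathbb{X}_2 \leftrightarrow \cdots \leftrightarrow \mathbb{X}_n$ and $\mathbb{Y}_1 \leftrightarrow \mathbb{Y}_2 \leftrightarrow \cdots \leftrightarrow \mathbb{Y}_n$ be two sequences (zigzag diagrams) of topological spaces and continuous maps, and let $\mathrm{Dg}\,\mathbf{X}$ and $\mathrm{Dg}\,\mathbf{Y}$ be their corresponding zigzag persistence diagrams (in a fixed homology dimension $p$, over a fixed field $\mathbb{K}$). Consider an interval $I=[r_1,r_2]\subset\mathbb{R}$ and let $\mathrm{Dg}\,\mathbf{X}^I$ and $\mathrm{Dg}\,\mathbf{Y}^I$ be the restrictions of these diagrams to $I$. Then $$d_B(\mathrm{Dg}\,\mathbf{X}^I,\mathrm{Dg}\,\mathbf{Y}^I)\le d_B(\mathrm{Dg}\,\mathbf{X},\mathrm{Dg}\,\mathbf{Y}).$$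
   Context: Zigzag diagrams and modules. A zigzag diagram of topological spaces is a sequence $\mathbb{X}_1\leftrightarrow\cdots\leftrightarrow\mathbb{X}_n$ where each $\leftrightarrow$ is a continuous map going either forwards or backwards. Applying the $p$-th homology functor with coefficients in a field $\mathbb{K}$ gives a diagram of vector spaces $\mathsf{H}_p(\mathbb{X}_1)\leftrightarrow\cdots\leftrightarrow \mathsf{H}_p(\mathbb{X}_n)$, called a zigzag module and denoted $\mathbf{X}$. It decomposes as $\mathbf{X}\cong\bigoplus_{j\in J}\mathbb{I}[b_j,d_j]$, where $\mathbb{I}[b,d]$ is the interval module that is $\mathbb{K}$ at the indices in $[b,d]$ (with identity maps between consecutive copies of $\mathbb{K}$) and $0$ elsewhere. Persistence diagram. $\mathrm{Dg}\,\mathbf{X}$ is the multiset of points $(b_j,d_j)$, $j\in J$, together with countably many copies of every point of the diagonal $\Delta=\{(x,x):x\in\mathbb{R}\}$. Bottleneck distance. $d_B(\mathrm{Dg}\,\mathbf{X},\mathrm{Dg}\,\mathbf{Y})=\inf_\mu\sup_x\|x-\mu(x)\|_\infty$, where $\mu$ ranges over all bijections between the two multisets (diagonal points included). Restriction of a diagram. For $I=[r_1,r_2]\subset\mathbb{R}$, the restriction $\mathrm{Dg}\,\mathbf{X}^I$ of $\mathrm{Dg}\,\mathbf{X}$ to $I$ is the multiset image of $\mathrm{Dg}\,\mathbf{X}$ (multiplicities retained) under the map $\Pi$ given by (A) $\Pi(b,d)=(b,d)$ if $r_1\le b\le d\le r_2$; (B) $\Pi(b,d)=(b,r_2)$ if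 $r_1\le b\le r_2\le d$; (C) $\Pi(b,d)=(r_1,d)$ if $b\le r_1\le d\le r_2$; (D) $\Pi(b,d)=(r_1,r_2)$ if $b\le r_1\le r_2\le d$; (E) $\Pi(b,d)=(b,b)$ if $r_2\le b$; (F) $\Pi(b,d)=(d,d)$ if $d\le r_1$. Like every persistence diagram, the restricted diagram contains countably many copies of every diagonal point. *)

(* Defs.v *)
From HB Require Import structures.
From mathcomp Require Import all_boot all_order all_algebra.
From mathcomp Require Import all_classical all_reals all_analysis.
From mathcomp.multinomials Require Import freeg.
From mathcomp Require Import lra.

Set Implicit Arguments.
Unset Strict Implicit.
Unset Printing Implicit Defensive.

Import Order.TTheory GRing.Theory Num.Theory numFieldNormedType.Exports.
Local Open Scope classical_set_scope.
Local Open Scope ring_scope.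

Section LmodQuotient.
Context (K : fieldType) (V : lmodType K) (B : submodClosed V).

Lemma submod_oppr_closed : oppr_closed B.
Proof. by move=> x Bx; rewrite -scaleN1r rpredZ. Qed.

Definition submod_zmod : zmodClosed V :=
  HB.pack (GRing.SubmodClosed.sort B)
    (GRing.isOppClosed.Build V B submod_oppr_closed).

Definition lquot : Type := Quotient.quot submod_zmod.

HB.instance Definition _ := GRing.Zmodule.on lquot.

Definition lquot_pi (x : V) : lquot := (\pi_(Quotient.quot submod_zmod) x)%qT.

Lemma lquot_piE x y : (lquot_pi x = lquot_pi y) <-> (x - y \in B).
Proof.
rewrite -[_ \in B]/(_ \in submod_zmod) Quotient.idealrBE; split=> [h|/eqP//].
by apply/eqP; exact: h.
Qed.

Lemma lquot_piK (q : lquot) :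
  lquot_pi (repr (q : Quotient.quot submod_zmod)) = q.
Proof. exact: reprK. Qed.

Lemma lquot_repr_pi x : repr (lquot_pi x : Quotient.quot submod_zmod) - x \in B.
Proof. by apply/lquot_piE; rewrite lquot_piK. Qed.

Lemma lquot_piD x y : lquot_pi (x + y) = lquot_pi x + lquot_pi y.
Proof. exact: raddfD. Qed.

Definition lquot_scale (a : K) (q : lquot) : lquot :=
  lquot_pi (a *: repr (q : Quotient.quot submod_zmod)).

Lemma lquot_piZ a x : lquot_scale a (lquot_pi x) = lquot_pi (a *: x).
Proof.
by apply/lquot_piE; rewrite -scalerBr rpredZ // lquot_repr_pi.
Qed.

Lemma lquot_scaleA a b q :
  lquot_scale a (lquot_scale b q) = lquot_scale (a * b) q.
Proof. by rewrite -[q]lquot_piK !lquot_piZ scalerA. Qed.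

Lemma lquot_scale1 : left_id 1 lquot_scale.
Proof. by move=> q; rewrite -[q]lquot_piK lquot_piZ scale1r. Qed.

Lemma lquot_scaleDr : right_distributive lquot_scale +%R.
Proof.
move=> a q q'; rewrite -[q]lquot_piK -[q']lquot_piK.
by rewrite -lquot_piD !lquot_piZ -lquot_piD scalerDr.
Qed.

Lemma lquot_scaleDl q : {morph lquot_scale^~ q : a b / a + b}.
Proof.
by move=> a b /=; rewrite -[q]lquot_piK !lquot_piZ -lquot_piD scalerDl.
Qed.

HB.instance Definition _ := GRing.Zmodule_isLmodule.Build K lquot
  lquot_scaleA lquot_scale1 lquot_scaleDr lquot_scaleDl.

End LmodQuotient.

Section LmodQuotientMap.
Context (K : fieldType) (V W : lmodType K).
Context (B : submodClosed V) (C : submodClosed W).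
Context (f : {linear V -> W}) (fBC : forall x, x \in B -> f x \in C).

Definition lquot_map (q : lquot B) : lquot C :=
  lquot_pi C (f (repr (q : Quotient.quot (submod_zmod B)))).

Lemma lquot_map_pi x : lquot_map (lquot_pi B x) = lquot_pi C (f x).
Proof.
by apply/lquot_piE; rewrite -linearB /=; apply/fBC/lquot_repr_pi.
Qed.

Lemma lquot_map_is_linear : linear lquot_map.
Proof.
move=> a q q'; rewrite -[q]lquot_piK -[q']lquot_piK.
rewrite -[a *: _]/(lquot_scale _ _) lquot_piZ -lquot_piD !lquot_map_pi.
by rewrite linearP lquot_piD -lquot_piZ.
Qed.

End LmodQuotientMap.
Arguments lquot_map {K V W} B C f q.

Section DirectSum.
Context (K : fieldType) (J : Type).

Record dsum (V : J -> lmodType K) := DSum {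
  dsum_fun :> forall j, V j;
  dsum_finite : finite_set [set j | dsum_fun j != 0] }.

HB.instance Definition _ V := gen_eqMixin (dsum V).
HB.instance Definition _ V := gen_choiceMixin (dsum V).

Lemma dsumP V (x y : dsum V) : (forall j, x j = y j) -> x = y.
Proof.
case: x y => [x xf] [y yf] /= xy.
have {xy} : x = y by exact: functional_extensionality_dep.
by move=> xy; subst y; congr DSum; exact: Prop_irrelevance.
Qed.

Context (V : J -> lmodType K).

Lemma dsum0_finite : finite_set [set j | (0 : V j) != 0].
Proof. by apply: sub_finite_set (finite_set0 J) => j /=; rewrite eqxx. Qed.
Definition dsum0 : dsum V := DSum dsum0_finite.

Lemma dsumN_finite (x : dsum V) : finite_set [set j | - x j != 0].
Proof.
by apply: sub_finite_set (dsum_finite x) => j /=; rewrite oppr_eq0.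
Qed.
Definition dsumN x : dsum V := DSum (dsumN_finite x).

Lemma dsumD_finite (x y : dsum V) : finite_set [set j | x j + y j != 0].
Proof.
have : finite_set ([set j | x j != 0] `|` [set j | y j != 0]).
  by rewrite finite_setU; split; exact: dsum_finite.
apply: sub_finite_set => j /=; have [->|] := eqVneq (x j) 0; last by left.
by rewrite add0r; right.
Qed.
Definition dsumD x y : dsum V := DSum (dsumD_finite x y).

Lemma dsumZ_finite (a : K) (x : dsum V) : finite_set [set j | a *: x j != 0].
Proof.
apply: sub_finite_set (dsum_finite x) => j /=.
by apply: contra => /eqP ->; rewrite scaler0.
Qed.
Definition dsumZ a x : dsum V := DSum (dsumZ_finite a x).

Lemma dsumDA : associative dsumD.
Proof. by move=> x y z; apply: dsumP => j /=; rewrite addrA. Qed.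
Lemma dsumDC : commutative dsumD.
Proof. by move=> x y; apply: dsumP => j /=; rewrite addrC. Qed.
Lemma dsum0D : left_id dsum0 dsumD.
Proof. by move=> x; apply: dsumP => j /=; rewrite add0r. Qed.
Lemma dsumND : left_inverse dsum0 dsumN dsumD.
Proof. by move=> x; apply: dsumP => j /=; rewrite addNr. Qed.
HB.instance Definition _ :=
  GRing.isZmodule.Build (dsum V) dsumDA dsumDC dsum0D dsumND.

Lemma dsumZA a b x : dsumZ a (dsumZ b x) = dsumZ (a * b) x.
Proof. by apply: dsumP => j /=; rewrite scalerA. Qed.
Lemma dsumZ1 : left_id 1 dsumZ.
Proof. by move=> x; apply: dsumP => j /=; rewrite scale1r. Qed.
Lemma dsumZDr : right_distributive dsumZ +%R.
Proof. by move=> a x y; apply: dsumP => j /=; rewrite scalerDr. Qed.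
Lemma dsumZDl x : {morph dsumZ^~ x : a b / a + b}.
Proof. by move=> a b; apply: dsumP => j /=; rewrite scalerDl. Qed.
HB.instance Definition _ := GRing.Zmodule_isLmodule.Build K (dsum V)
  dsumZA dsumZ1 dsumZDr dsumZDl.

End DirectSum.

Section DirectSumMap.
Context (K : fieldType) (J : Type) (V W : J -> lmodType K).
Context (f : forall j, {linear V j -> W j}).

Lemma dsum_map_finite (x : dsum V) : finite_set [set j | f j (x j) != 0].
Proof.
apply: sub_finite_set (dsum_finite x) => j /=.
by apply: contra => /eqP ->; rewrite linear0.
Qed.

Definition dsum_map (x : dsum V) : dsum W := DSum (dsum_map_finite x).

Lemma dsum_map_is_linear : linear dsum_map.
Proof. by move=> a x y; apply: dsumP => j /=; rewrite linearP. Qed.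

HB.instance Definition _ :=
  GRing.isLinear.Build K (dsum V) (dsum W) _ dsum_map dsum_map_is_linear.

End DirectSumMap.

Section FreeLinear.
Context (K : fieldType) (S : choiceType) (M : lmodType K).

Lemma fglift_is_linear (f : S -> M) : linear (fglift f).
Proof.
have fD x y : fglift f (x + y) = fglift f x + fglift f y.
  rewrite -[y in LHS]opprK lift_is_additive -[- y]sub0r lift_is_additive.
  have -> : fglift f 0 = 0 by rewrite -(subrr 0) lift_is_additive subrr.
  by rewrite sub0r opprK.
move=> a x y; rewrite fD; congr (_ + _).
elim/freeg_ind_dom0: x => [|k s x _ _ IH].
  have f0 : fglift f 0 = 0 by rewrite -(subrr 0) lift_is_additive subrr.
  by rewrite scaler0 f0 scaler0.
rewrite scalerDr !fD IH scalerDr; congr (_ + _).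
have -> : a *: << k *g s >> = << (a * k) *g s >> :> {freeg S / K}.
  by apply/eqP/freeg_eqP => t; rewrite coeffZ !coeffU mulrA.
by rewrite !liftU scalerA.
Qed.

HB.instance Definition _ (f : S -> M) :=
  GRing.isLinear.Build K {freeg S / K} M _ (fglift f) (fglift_is_linear f).

Lemma freeg_linear_ext (f g : {linear {freeg S / K} -> M}) :
  (forall s, f << s >> = g << s >>) -> f =1 g.
Proof.
move=> fg; elim/freeg_ind_dom0 => [|k s x _ _ IH]; first by rewrite !linear0.
rewrite !linearD IH; congr (_ + _).
have -> : << k *g s >> = k *: << s >> :> {freeg S / K}.
  by apply/eqP/freeg_eqP => t; rewrite coeffZ !coeffU mul1r.
by rewrite !linearZ /= fg.
Qed.

End FreeLinear.

Section StandardSimplex.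
Context (R : realType).

Definition std_simplex p : set 'rV[R]_p.+1 :=
  [set x | (forall i, 0 <= x 0 i) /\ \sum_i x 0 i = 1].
Arguments std_simplex p : clear implicits.

(* [set_type] carries the subspace topology. *)
Definition simplex p := set_type (std_simplex p).
HB.instance Definition _ p := Topological.on (simplex p).

Definition face_row p (i : 'I_p.+2) (x : 'rV[R]_p.+1) : 'rV[R]_p.+2 :=
  \row_j oapp (x 0) 0 (unlift i j).

Lemma face_row_simplex p (i : 'I_p.+2) (x : simplex p) :
  face_row i (val x) \in std_simplex p.+1.
Proof.
have [x0 x1] := set_valP x.
apply/mem_set; split=> [j|].
  by rewrite mxE; case: unlift => [k|] /=.
rewrite (bigD1_ord i) //= mxE unlift_none /= add0r -[RHS]x1.
by apply: eq_bigr => k _; rewrite mxE liftK.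
Qed.

Definition face p (i : 'I_p.+2) (x : simplex p) : simplex p.+1 :=
  exist _ (face_row i (val x)) (face_row_simplex i x).

Lemma face_continuous p (i : 'I_p.+2) : continuous (@face p i).
Proof.
apply: continuous_comp_initial => x A /= [P Px sPA].
have : \forall y \near x, forall j, P 0 j (face_row i (val y) 0 j).
  apply: (@filter_forall _ _ (fun j y => P 0 j (face_row i (val y) 0 j))
    (nbhs x) (nbhs_filter x)) => j.
  have := Px 0 j; rewrite /= !mxE.
  case E : (unlift i j) => [k|] /= Pk.
    have /(_ x) : continuous (fun y : simplex p => val y 0 k).
      move=> y.
      have vc : continuous (val : simplex p -> 'rV[R]_p.+1).
        exact: initial_continuous.
      have cc : continuous (fun z : 'rV[R]_p.+1 => z 0 k).
        exact: coord_continuous.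
      exact: continuous_comp (vc y) (cc (val y)).
    move=> /(_ _ Pk); apply: (@filterS _ _ (nbhs_filter x)) => y /=.
    by rewrite mxE E.
  by apply: (@filterE _ _ (nbhs_filter x)) => y; rewrite mxE E /=;
    exact: nbhs_singleton Pk.
by apply: (@filterS _ _ (nbhs_filter x)) => y Py; apply: sPA => a j; rewrite ord1;
  exact: Py.
Qed.

HB.instance Definition _ p (i : 'I_p.+2) :=
  @isContinuous.Build (simplex p) (simplex p.+1) (face i)
    (@face_continuous p i).

End StandardSimplex.

Section SingularHomology.
Context (R : realType) (K : fieldType).

Definition singular p (X : topologicalType) := continuousType (simplex R p) X.

Definition sing_chain p X := {freeg (singular p X) / K}.

Definition sing_boundary p X : sing_chain p.+1 X -> sing_chain p X :=
  fglift (fun s : singular p.+1 X =>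
    \sum_(i < p.+2) (-1) ^+ i *: << (s \o face i : singular p X) >>).
HB.instance Definition _ p X := GRing.Linear.on (@sing_boundary p X).

Definition is_cycle p X : {pred sing_chain p X} :=
  match p return {pred sing_chain p X} with
  | 0 => fun _ => true
  | q.+1 => fun c => @sing_boundary q X c == 0
  end.

Lemma is_cycle_submod_closed p X : submod_closed (@is_cycle p X).
Proof.
case: p => [|p]; split=> //; first by apply/eqP; rewrite linear0.
move=> a x y /eqP x0 /eqP y0; apply/eqP.
by rewrite (linearP (@sing_boundary p X) a x y) /= x0 y0 scaler0 addr0.
Qed.
HB.instance Definition _ p X :=
  GRing.isSubmodClosed.Build K (sing_chain p X) (@is_cycle p X)
    (@is_cycle_submod_closed p X).

Record sing_cycle p X := Cycle { cycle_chain : sing_chain p X;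
                            _ : cycle_chain \in @is_cycle p X }.
HB.instance Definition _ p X := [isSub for @cycle_chain p X].
HB.instance Definition _ p X := [Choice of sing_cycle p X by <:].
HB.instance Definition _ p X :=
  [SubChoice_isSubZmodule of sing_cycle p X by <:].
HB.instance Definition _ p X :=
  [SubZmodule_isSubLmodule of sing_cycle p X by <:].

(* Every [sing_boundary c] is a cycle; boundaries are viewed inside cycles so
   that homology is the quotient of cycles by boundaries. *)
Definition is_boundary p X : {pred sing_cycle p X} :=
  fun z => `[< exists c : sing_chain p.+1 X, sing_boundary c = cycle_chain z >].

Lemma is_boundary_submod_closed p X : submod_closed (@is_boundary p X).
Proof.
split; first by apply/asboolP; exists 0; rewrite !linear0.
move=> a x y /asboolP[c cx] /asboolP[d dy]; apply/asboolP.
by exists (a *: c + d); rewrite linearP /= cx dy.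
Qed.
HB.instance Definition _ p X :=
  GRing.isSubmodClosed.Build K (sing_cycle p X) (@is_boundary p X)
    (@is_boundary_submod_closed p X).

Definition homology p X := lquot (@is_boundary p X).
HB.instance Definition _ p X := GRing.Lmodule.on (homology p X).

Section Functoriality.
Context (X Y : topologicalType) (f : continuousType X Y) (p : nat).

Definition chain_map : sing_chain p X -> sing_chain p Y :=
  fglift (fun s : singular p X => << (f \o s : singular p Y) >>).
HB.instance Definition _ := GRing.Linear.on chain_map.

End Functoriality.
Arguments chain_map {X Y} f {p} c : rename.

Lemma chain_map_boundary (X Y : topologicalType) (f : continuousType X Y) p
    (c : sing_chain p.+1 X) :
  sing_boundary (chain_map f c) = chain_map f (sing_boundary c).
Proof.
pose F : {linear sing_chain p.+1 X -> sing_chain p Y} :=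
  @sing_boundary p Y \o chain_map f.
pose G : {linear sing_chain p.+1 X -> sing_chain p Y} :=
  chain_map f \o @sing_boundary p X.
suff FG : forall s, F << s >> = G << s >> by exact: (freeg_linear_ext FG c).
move=> s; rewrite /F /G /=.
rewrite /chain_map /sing_boundary !liftU !scale1r liftU scale1r linear_sum.
apply: eq_bigr => i _; rewrite linearZ /= liftU scale1r.
by congr (_ *: << _ >>); apply/continuousEP.
Qed.

Section FunctorialityCycle.
Context (X Y : topologicalType) (f : continuousType X Y) (p : nat).

Lemma chain_map_cycle (z : sing_cycle p X) :
  chain_map f (cycle_chain z) \in @is_cycle p Y.
Proof.
case: p z => [//|q] [z /= /eqP z0]; apply/eqP.
by rewrite chain_map_boundary z0 linear0.
Qed.

Definition cycle_map (z : sing_cycle p X) : sing_cycle p Y :=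
  Cycle (chain_map_cycle z).

Lemma cycle_map_is_linear : linear cycle_map.
Proof. by move=> a x y; apply: val_inj; rewrite /= !linearP. Qed.
HB.instance Definition _ :=
  GRing.isLinear.Build K (sing_cycle p X) (sing_cycle p Y) _
    cycle_map cycle_map_is_linear.

Lemma cycle_map_boundary z :
  z \in @is_boundary p X -> cycle_map z \in @is_boundary p Y.
Proof.
move=> /asboolP[c cz]; apply/asboolP; exists (chain_map f c).
by rewrite chain_map_boundary cz.
Qed.

Definition homology_map : homology p X -> homology p Y :=
  lquot_map (@is_boundary p X) (@is_boundary p Y) cycle_map.
HB.instance Definition _ :=
  GRing.isLinear.Build K (homology p X) (homology p Y) _
    homology_map (lquot_map_is_linear cycle_map_boundary).

End FunctorialityCycle.

End SingularHomology.
Arguments homology_map R K {X Y} f p h : rename.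

(* A zigzag with [n.+1] vertices has [n] arrows; the arrow [k] joins the
   vertices [k] and [k.+1], and points forwards iff [t k] holds. *)
Definition zsrc n (t : 'I_n -> bool) (k : 'I_n) : 'I_n.+1 :=
  if t k then widen_ord (leqnSn n) k else fintype.lift ord0 k.
Definition ztgt n (t : 'I_n -> bool) (k : 'I_n) : 'I_n.+1 :=
  if t k then fintype.lift ord0 k else widen_ord (leqnSn n) k.

Record zigzag_diagram n := ZigzagDiagram {
  zd_dir : 'I_n -> bool;
  zd_space : 'I_n.+1 -> topologicalType;
  zd_map : forall k,
    continuousType (zd_space (zsrc zd_dir k)) (zd_space (ztgt zd_dir k)) }.

Record zigzag_module (K : fieldType) n (t : 'I_n -> bool) := ZigzagModule {
  zm_space : 'I_n.+1 -> lmodType K;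
  zm_map : forall k, {linear zm_space (zsrc t k) -> zm_space (ztgt t k)} }.

Definition zm_iso K n (t : 'I_n -> bool) (M N : zigzag_module K t) : Prop :=
  exists phi : forall i, {linear zm_space M i -> zm_space N i},
    (forall i, bijective (phi i)) /\
    (forall k x, phi (ztgt t k) (zm_map M k x) = zm_map N k (phi (zsrc t k) x)).

Definition zigzag_homology (R : realType) (K : fieldType) (p n : nat)
    (X : zigzag_diagram n) : zigzag_module K (zd_dir X) :=
  @ZigzagModule K n (zd_dir X)
    (fun i => homology R K p (zd_space X i))
    (fun k => homology_map R K (zd_map X k) p).

Section IntervalModule.
Context (K : fieldType).

Definition interval_space (c : bool) : lmodType K :=
  if c then (K^o : lmodType K) else ('rV[K]_0 : lmodType K).

Definition interval_map (c c' : bool) :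
    {linear interval_space c -> interval_space c'} :=
  match c, c' with
  | true, true => idfun
  | _, _ => \0
  end.

Definition interval_module n (t : 'I_n -> bool) (b d : 'I_n.+1) :
    zigzag_module K t :=
  @ZigzagModule K n t (fun i => interval_space (b <= i <= d)%N)
    (fun k => interval_map _ _).

Definition zm_dsum n (t : 'I_n -> bool) (J : Type)
    (M : J -> zigzag_module K t) :
    zigzag_module K t :=
  @ZigzagModule K n t (fun i => dsum (fun j => zm_space (M j) i))
    (fun k => dsum_map (fun j => zm_map (M j) k)).

End IntervalModule.

(* [I[b, d]] is given by the vertices [b <= d], numbered from 0. *)
Record interval_decomposition K n (t : 'I_n -> bool) (M : zigzag_module K t) :=
  IntervalDecomposition {
    dec_index : Type;
    dec_birth : dec_index -> 'I_n.+1;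
    dec_death : dec_index -> 'I_n.+1;
    dec_birth_death : forall j, (dec_birth j <= dec_death j)%N;
    dec_iso : zm_iso M
      (zm_dsum (fun j => interval_module K t (dec_birth j) (dec_death j))) }.

(* Multisets are indexed families, so that a bijection between two multisets,
   which matches points with multiplicity, is a bijection of index types. *)
Record multiset (T : Type) := Multiset {
  ms_index : Type;
  ms_point :> ms_index -> T }.

Definition ms_image T U (f : T -> U) (A : multiset T) : multiset U :=
  Multiset (f \o A).

Section PersistenceDiagram.
Context (R : realType).

(* Vertices are numbered from 1, hence the shift [.+1].  The second summand
   provides countably many copies of each point of the diagonal. *)
Definition Dg K n (t : 'I_n -> bool) (M : zigzag_module K t)
    (D : interval_decomposition M) : multiset (R * R) :=
  @Multiset (R * R) (dec_index D + R * nat)%type (fun u =>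
    match u with
    | inl j => ((dec_birth j).+1%:R, (dec_death j).+1%:R)
    | inr (x, _) => (x, x)
    end).

(* [`|_|] on [R * R] is the sup norm; the infimum is [+oo] if there is no
   bijection between the two multisets. *)
Definition bottleneck (A B : multiset (R * R)) : \bar R :=
  ereal_inf [set ereal_sup [set `|A x - B (mu x)|%:E | x in [set: ms_index A]]
            | mu in [set mu : ms_index A -> ms_index B | bijective mu]].

(* The cases are tried in order. For [r1 <= r2] and [b <= d] they are
   exhaustive and agree where they overlap, see [restrict_pointP]. *)
Definition restrict_point (r1 r2 : R) (u : R * R) : R * R :=
  let: (b, d) := u in
  if [&& r1 <= b, b <= d & d <= r2] then (b, d)
  else if [&& r1 <= b, b <= r2 & r2 <= d] then (b, r2)
  else if [&& b <= r1, r1 <= d & d <= r2] then (r1, d)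
  else if [&& b <= r1, r1 <= r2 & r2 <= d] then (r1, r2)
  else if r2 <= b then (b, b)
  else (d, d).

Lemma restrict_pointP (r1 r2 b d : R) : r1 <= r2 -> b <= d ->
  [/\ [/\ r1 <= b -> d <= r2 -> restrict_point r1 r2 (b, d) = (b, d),
          r1 <= b -> b <= r2 -> r2 <= d -> restrict_point r1 r2 (b, d) = (b, r2)
        & b <= r1 -> r1 <= d -> d <= r2 ->
            restrict_point r1 r2 (b, d) = (r1, d)],
      b <= r1 -> r2 <= d -> restrict_point r1 r2 (b, d) = (r1, r2),
      r2 <= b -> restrict_point r1 r2 (b, d) = (b, b)
    & d <= r1 -> restrict_point r1 r2 (b, d) = (d, d)].
Proof.
move=> r12 bd; rewrite /restrict_point bd r12 /=.
split; first split; (do ?[move=> /[dup] ? ->]); rewrite ?andbT /=;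
  do ?[ case: ifP => [/and3P[? ? ?]|?]
      | case: ifP => [/andP[? ?]|?] | case: ifP => [?|?] ] => //;
  move=> *; congr (_, _); lra.
Qed.

(* [restrict_point] fixes the diagonal, so the image still contains countably
   many copies of each of its points. *)
Definition restrict_diagram (r1 r2 : R) (A : multiset (R * R)) :
    multiset (R * R) :=
  ms_image (restrict_point r1 r2) A.

End PersistenceDiagram.

(* Main.v *)
Require Import Defs.
From mathcomp Require Import all_boot all_order all_algebra.
From mathcomp Require Import all_classical all_reals all_analysis.
From mathcomp Require Import lra.

(** Read [(b, d)] as the interval from [b] to [d].  On intervals, that is for
    [b <= d], the six cases of the restriction to [[r1, r2]] are those of one
    formula,
      Pi (b, d) = (max b (min r1 d), min d (max r2 b)),
    see [restrict_point_minmax].  Since [max] and [min] are nonexpansive for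
    the sup norm, so is Pi ([restrict_point_nonexpansive]).  Every bijection
    between the two diagrams is also a bijection between their restrictions,
    on the same indices, and it moves no restricted point farther than the
    original one; its cost can only drop, and hence so does the infimum of the
    costs ([bottleneck_image_le]).  The points of a zigzag persistence diagram
    are intervals in this sense, the diagonal ones trivially ([Dg_le]). *)

Import Order.TTheory GRing.Theory Num.Theory.
Local Open Scope ring_scope.

Lemma max_min_nonexpansive {R : realDomainType} {a b c d e : R} :
  `|a - c| <= e -> `|b - d| <= e ->
  `|Num.max a b - Num.max c d| <= e /\ `|Num.min a b - Num.min c d| <= e.
Proof.
rewrite !ler_norml => /andP[? ?] /andP[? ?].
by split; case: (leP a b) => ?; case: (leP c d) => ?; lra.
Qed.

Lemma norm_pair_le (R : realType) (u : R * R) (e : R) :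
  (`|u| <= e) = (`|u.1| <= e) && (`|u.2| <= e).
Proof. by rewrite prod_normE ge_max. Qed.

(** For [b <= r2] and [r1 <= d], the components are the projections of
    [b] and [d] onto [[r1, r2]].  An interval ending before [r1] collapses to
    its death because [min r1 d = d]; one starting after [r2] collapses to its
    birth because [max r2 b = b]. *)
Lemma restrict_point_minmax (R : realType) (r1 r2 b d : R) :
  r1 <= r2 -> b <= d ->
  restrict_point r1 r2 (b, d)
    = (Num.max b (Num.min r1 d), Num.min d (Num.max r2 b)).
Proof.
move=> r12 bd; have [[caseA caseB caseC] caseD caseE caseF] :=
  restrict_pointP r12 bd.
have [r2b|br2] := leP r2 b.
  rewrite caseE // (min_idPl _) ?(le_trans r12 (le_trans r2b bd)) //.
  by rewrite (max_idPl (le_trans r12 r2b)) (min_idPr bd).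
have [dr1|r1d] := leP d r1.
  by rewrite caseF // (max_idPr bd) (min_idPl (le_trans dr1 r12)).
have [r1b|br1] := leP r1 b; have [dr2|r2d] := leP d r2.
- by rewrite caseA.
- by rewrite caseB // ltW.
- by rewrite caseC // ltW.
- by rewrite caseD // ltW.
Qed.

Lemma restrict_point_nonexpansive (R : realType) (r1 r2 : R) (u v : R * R) :
  r1 <= r2 -> u.1 <= u.2 -> v.1 <= v.2 ->
  `|restrict_point r1 r2 u - restrict_point r1 r2 v| <= `|u - v|.
Proof.
case: u v => [b d] [b' d'] r12 bd bd'.
rewrite !restrict_point_minmax //.
have /andP[/= bb' dd'] : (`|((b, d) - (b', d')).1| <= `|(b, d) - (b', d')|)
    && (`|((b, d) - (b', d')).2| <= `|(b, d) - (b', d')|).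
  by rewrite -norm_pair_le.
have rr (r : R) : `|r - r| <= `|(b, d) - (b', d')| by rewrite subrr normr0.
rewrite norm_pair_le; apply/andP; split => /=.
- have [_ inner] := max_min_nonexpansive (rr r1) dd'.
  by have [] := max_min_nonexpansive bb' inner.
- have [inner _] := max_min_nonexpansive (rr r2) bb'.
  by have [] := max_min_nonexpansive dd' inner.
Qed.

Lemma Dg_le (R : realType) (K : fieldType) (n : nat) (t : 'I_n -> bool)
    (M : zigzag_module K t) (D : interval_decomposition M)
    (u : ms_index (Dg R D)) : (Dg R D u).1 <= (Dg R D u).2.
Proof. by case: u => [j|[x k]] //=; rewrite ler_nat ltnS dec_birth_death. Qed.

Local Open Scope ereal_scope.

(** The map has to be nonexpansive only between points of the two multisets.
    The image multisets are indexed as the originals are, so that one and the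
    same bijection of indices serves on both sides. *)
Lemma bottleneck_image_le (R : realType) (f : R * R -> R * R)
    (A B : multiset (R * R)) :
  (forall x y, `|f (A x) - f (B y)| <= `|A x - B y|)%R ->
  bottleneck (ms_image f A) (ms_image f B) <= bottleneck A B.
Proof.
move=> f_nonexp; apply: le_ereal_inf_tmp => _ [mu mu_bij <-].
apply: ge_ereal_inf; exists (ereal_sup
  [set `|f (A x) - f (B (mu x))|%:E | x in [set: ms_index A]])%classic.
  by exists mu.
apply: ge_ereal_sup => _ [x _ <-].
apply: (@le_trans _ _ (`|A x - B (mu x)|%:E)); first by rewrite lee_fin.
by apply: ereal_sup_ubound; exists x.
Qed.

Theorem theorem2 (R : realType) (K : fieldType) (p n : nat)
    (X Y : zigzag_diagram n)
    (DX : interval_decomposition (zigzag_homology R K p X))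
    (DY : interval_decomposition (zigzag_homology R K p Y))
    (r1 r2 : R) (hr : (r1 <= r2)%R) :
  bottleneck (restrict_diagram r1 r2 (Dg R DX))
             (restrict_diagram r1 r2 (Dg R DY))
    <= bottleneck (Dg R DX) (Dg R DY).
Proof.
apply: bottleneck_image_le => x y.
by apply: restrict_point_nonexpansive; rewrite ?Dg_le.
Qed.
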